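(* Let $n$ be even. Choose a matrix $A\in\mathbb{Z}_2^{(n/2)\times n}$ by setting each entry to $0$ or $1$ uniformly and independently, and let $S=\{x\in\{0,1\}^n : Ax\equiv 0 \pmod 2\}$, a subgroup of $\mathbb{Z}_2^n$. Let $f_S:\{0,1\}^n\to\{0,1\}$ be given by $f_S(x)=1$ if $x\in S$ and $f_S(x)=0$ otherwise, and let $|S\rangle=\frac{1}{\sqrt{|S|}}\sum_{x\in S}|x\rangle$. Then $\mathrm{MFS}(f_S)=n^{\Omega(\log n)}$ (and hence $\mathrm{TS}(|S\rangle)=n^{\Omega(\log n)}$) with probability $\Omega(1)$ over $S$. That is, there are constants $c,c'>0$ such that for all sufficiently large even $n$, with probability at least $c'$ over the choice of $S$, both $\mathrm{MFS}(f_S)\ge n^{c\log n}$ and $\mathrm{TS}(|S\rangle)\ge n^{c\log n}$.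
   Context: Multilinear formulas. An arithmetic formula over $\mathbb{C}$ in variables $x_1,\dots,x_n$ is a rooted binary tree whose leaves are labeled with complex numbers or variables and whose non-leaf vertices are labeled $+$ or $\times$; it computes a polynomial in the obvious way. A polynomial is multilinear if no variable appears raised to a power higher than $1$; a formula is multilinear if the polynomial computed by each of its subtrees is multilinear. The size of a formula is its number of leaves. For a multilinear polynomial $p$, $\mathrm{MFS}(p)$ is the minimum size of a multilinear formula computing $p$; for $f:\{0,1\}^n\to\mathbb{C}$, $\mathrm{MFS}(f)$ is the minimum of $\mathrm{MFS}(p)$ over multilinear $p$ with $p(x)=f(x)$ for all $x\in\{0,1\}^n$. Tree size. A quantum state tree over $(\mathbb{C}^2)^{\otimes n}$ is a rooted tree in which each leaf is labeled with $\alpha|0\rangle+\beta|1\rangle$ for some $\alpha,\beta\in\mathbb{C}$, each non-leaf vertex (gate, of arbitrary fan-in) is labeled with $+$ or $\otimes$, and each vertex $v$ is labeled with a set $S(v)\subseteq\{1,\dots,n\}$ (of qubits) such that: (i) $|S(v)|=1$ if $v$ is a leaf; (ii) $S(v)=\{1,\dots,n\}$ if $v$ is the root; (iii) if $v$ is a $+$ gate and $w$ is a child of $v$ then $S(w)=S(v)$; (iv) if $v$ is a $\otimes$ gate with children $w_1,\dots,w_k$ then $S(w_1),\dots,S(w_k)$ form a partition of $S(v)$. The outgoing edges of each $+$ gate are labeled with complex numbers. The subtree at $v$ represents a state of the qubits in $S(v)$ in the obvious way (linear combination with edge labels as coefficients, respectively tensor product), and this state is required to be normalized for every $v$. $\mathrm{TS}(|\psi\rangle)$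 is the minimum number of leaves of a tree representing $|\psi\rangle$. *)

(* Defs.v *)
From mathcomp Require Import all_boot all_order all_algebra.
From mathcomp Require Import complex.
From mathcomp Require Import mpoly.
From mathcomp Require Import boolp reals.

Set Implicit Arguments.
Unset Strict Implicit.
Unset Printing Implicit Defensive.

Import Order.TTheory GRing.Theory Num.Theory.
Local Open Scope ring_scope.
Local Open Scope complex_scope.

(* The minimum of an empty set is 0, so that no lower bound on a minimum can
   hold merely because nothing is being minimized. *)
Definition nat_min (P : nat -> Prop) : nat :=
  match pselect (exists k, `[< P k >]) with
  | left exP => ex_minn exP
  | right _ => 0%N
  end.

Lemma nat_minP (P : nat -> Prop) : (exists k, P k) ->
  P (nat_min P) /\ forall k, P k -> (nat_min P <= k)%N.
Proof.
move=> [k Pk]; rewrite /nat_min; case: pselect => [exP|nexP]; last first.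
  by case: nexP; exists k; apply/asboolP.
case: ex_minnP => m /asboolP Pm min_m; split=> // j Pj.
by apply: min_m; apply/asboolP.
Qed.

(* The cube {0,1}^n. *)
Definition bits (n : nat) := {ffun 'I_n -> bool}.

Section MultilinearFormulas.
Variables (R : realType) (n : nat).
Local Notation C := (R[i]).

Inductive formula :=
  | FConst of C
  | FVar of 'I_n
  | FAdd of formula & formula
  | FMul of formula & formula.

Fixpoint formula_poly (F : formula) : {mpoly C[n]} :=
  match F with
  | FConst a => a%:MP
  | FVar i => 'X_i
  | FAdd F1 F2 => formula_poly F1 + formula_poly F2
  | FMul F1 F2 => formula_poly F1 * formula_poly F2
  end.

Fixpoint formula_size (F : formula) : nat :=
  match F with
  | FConst _ | FVar _ => 1%N
  | FAdd F1 F2 | FMul F1 F2 => (formula_size F1 + formula_size F2)%N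
  end.

Definition multilinear (p : {mpoly C[n]}) : Prop :=
  forall m, m \in msupp p -> forall i : 'I_n, (m i <= 1)%N.

Fixpoint multilinear_formula (F : formula) : Prop :=
  multilinear (formula_poly F) /\
  match F with
  | FConst _ | FVar _ => True
  | FAdd F1 F2 | FMul F1 F2 => multilinear_formula F1 /\ multilinear_formula F2
  end.

Definition MFS_poly (p : {mpoly C[n]}) : nat :=
  nat_min (fun k => exists F : formula,
    [/\ multilinear_formula F, formula_poly F = p & formula_size F = k]).

Definition MFS (f : bits n -> C) : nat :=
  nat_min (fun k => exists p : {mpoly C[n]},
    [/\ multilinear p,
        forall x : bits n, p.@[fun i => (x i)%:R] = f x
      & MFS_poly p = k]).

End MultilinearFormulas.

Section QuantumStateTrees.
Variables (R : realType) (n : nat).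
Local Notation C := (R[i]).

(* A state of the qubits in a set S of qubits is encoded by its amplitudes
   pulled back along the restriction {0,1}^n -> {0,1}^S: it is a function on
   {0,1}^n that depends only on the bits in S.  Tensor products over disjoint
   sets of qubits are then pointwise products. *)
Definition state := bits n -> C.

(* The sum has one term for each element of {0,1}^S, namely its extension by
   zero to {0,1}^n. *)
Definition normalized (S : {set 'I_n}) (psi : state) : Prop :=
  \sum_(x : bits n | [forall i, x i ==> (i \in S)]) `|psi x| ^+ 2 = 1.

(* A gate carries its set Q = S(v) of qubits, its fan-in k.+1, its children and, in
   the case of a + gate, the labels of its outgoing edges. *)
Inductive qtree :=
  | QLeaf (i : 'I_n) (alpha beta : C)
  | QPlus (Q : {set 'I_n}) (k : nat) (a : 'I_k.+1 -> C) (w : 'I_k.+1 -> qtree)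
  | QTensor (Q : {set 'I_n}) (k : nat) (w : 'I_k.+1 -> qtree).

Definition qubits (t : qtree) : {set 'I_n} :=
  match t with
  | QLeaf i _ _ => [set i]
  | QPlus Q _ _ _ | QTensor Q _ _ => Q
  end.

Fixpoint amplitude (t : qtree) : state :=
  match t with
  | QLeaf i alpha beta => fun x => if x i then beta else alpha
  | QPlus _ k a w => fun x => \sum_(j < k.+1) a j * amplitude (w j) x
  | QTensor _ k w => fun x => \prod_(j < k.+1) amplitude (w j) x
  end.

Fixpoint leaves (t : qtree) : nat :=
  match t with
  | QLeaf _ _ _ => 1%N
  | QPlus _ k _ w | QTensor _ k w => (\sum_(j < k.+1) leaves (w j))%N
  end.

(* Children of a tensor gate must not repeat a block: injectivity turns the
   partition by the set of all S(w_j) into one by the family S(w_1), S(w_2), ... *)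
Fixpoint well_formed (t : qtree) : Prop :=
  normalized (qubits t) (amplitude t) /\
  match t with
  | QLeaf _ _ _ => True
  | QPlus Q k _ w =>
      forall j : 'I_k.+1, qubits (w j) = Q /\ well_formed (w j)
  | QTensor Q k w =>
      [/\ partition [set qubits (w j) | j : 'I_k.+1] Q,
          injective (fun j : 'I_k.+1 => qubits (w j))
        & forall j : 'I_k.+1, well_formed (w j)]
  end.

Definition represents (t : qtree) (psi : state) : Prop :=
  [/\ well_formed t, qubits t = [set: 'I_n] & amplitude t =1 psi].

Definition TS (psi : state) : nat :=
  nat_min (fun k => exists t : qtree, represents t psi /\ leaves t = k).

End QuantumStateTrees.

Section Subgroup.
Variables (R : realType) (m n : nat).
Local Notation C := (R[i]).

Definition kernel_set (A : 'M['F_2]_(m, n)) : {set bits n} :=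
  [set x : bits n | A *m (\col_i (x i)%:R) == 0].

Definition indicator (S : {set bits n}) : bits n -> C :=
  fun x => (x \in S)%:R.

Definition uniform_state (S : {set bits n}) : state R n :=
  fun x => ((Num.sqrt (#|S|%:R : R))^-1)%:C * (x \in S)%:R.

Definition coin (b : 'F_2) : R := 2^-1.

(* Probability of an event when the entries of A are independent fair coins. *)
Definition Pr (E : 'M['F_2]_(m, n) -> Prop) : R :=
  \sum_(A : 'M['F_2]_(m, n) | `[< E A >])
    \prod_(i < m) \prod_(j < n) coin (A i j).

End Subgroup.

(* Main.v *)
(* Proof idea (Raz's method, after Aaronson). A syntactically multilinear formula
   or a quantum state tree of size s computes a sum of at most s products
   f * g, where f again has a small formula, on a set V of variables, and g
   depends on the other variables; V can be chosen to hold between a quarter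
   and a half of the variables. Iterating t times inside f, the function is a sum
   of at most s terms, each with t disjoint blocks W_1, ..., W_t of variables
   such that the term factors as f_j(W_j) * g_j(complement of W_j) for every j.

   View a function as a matrix whose rows are indexed by the bits in a set Y of
   half of the n = 2m variables and whose columns are indexed by the others. If
   Y splits some W_j with discrepancy at least k, the term has rank at most
   2^(m-k). A block of size at least 2^(8a) is split with discrepancy less than
   2^a with probability at most 2^-a, and the blocks are independent for a
   uniform subset Y; conditioning on |Y| = m costs only a factor n + 1. With
   2^(16a) <= n, t = 4a and k = 2^a, most Y thus give the function rank at most
   s * 2^(m-k) unless s >= 2^(a^2).

   On the other hand the matrix of the indicator of ker A has rank at least
   2^m / (|ker A_Y| * |ker A_Z|), where A_Y and A_Z are the column blocks of A;
   these kernels have expected size less than 2, so by Markov's inequality at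
   least half of the matrices A have rank at least 2^m / 64 for at least half
   of the sets Y. Hence s >= 2^(a^2), where a is about (log n) / 16. *)
Require Import Defs.
From mathcomp Require Import all_boot all_order all_algebra.
From mathcomp Require Import complex.
From mathcomp Require Import reals exp.
From mathcomp Require Import -(notations) mpoly.
From mathcomp Require Import zify lra boolp.

Set Implicit Arguments.
Unset Strict Implicit.
Unset Printing Implicit Defensive.

Import Order.TTheory GRing.Theory Num.Theory.
Local Open Scope ring_scope.

(** * Syntactically multilinear computations and the rank of a partition *)

Lemma subset_between (T : finType) (A B : {set T}) k :
  A \subset B -> (#|A| <= k <= #|B|)%N ->
  exists C : {set T}, [/\ A \subset C, C \subset B & #|C| = k].
Proof.
move=> sAB /andP[]; elim: k => [|k IH] Ak kB.
  by exists A; split=> //; apply/eqP; rewrite -leqn0.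
move: Ak; rewrite leq_eqVlt => /predU1P[Ak|Ak]; first by exists A.
have [C [AC CB cC]] := IH Ak (ltnW kB).
have /subsetPn[i iB iC] : ~~ (B \subset C).
  by apply: contraTN kB => /subset_leq_card; rewrite cC -ltnNge ltnS.
exists (i |: C); split; last by rewrite cardsU1 iC cC.
  exact: subset_trans AC (subsetUr _ _).
by rewrite subUset sub1set iB.
Qed.

Section Computation.
Variables (n : nat) (K : fieldType).
Implicit Types (S T U V W Y : {set 'I_n}) (f g h : bits n -> K) (x y : bits n).

Definition depends S f := forall x y, {in S, x =1 y} -> f x = f y.

Lemma dependsS S T f : S \subset T -> depends S f -> depends T f.
Proof. by move=> /subsetP sST df x y xy; apply: df => i /sST; apply: xy. Qed.

Lemma dependsM S T f g : depends S f -> depends T g -> depends (S :|: T) (f \* g).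
Proof.
move=> df dg x y xy /=; congr (_ * _).
  by apply: df => i iS; apply: xy; rewrite inE iS.
by apply: dg => i iT; apply: xy; rewrite inE iT orbT.
Qed.

(* The value of a binary tree with at most s leaves; a leaf is any function of at
   most one variable, and both formulas and quantum state trees are instances. *)
Inductive computes : nat -> {set 'I_n} -> (bits n -> K) -> Prop :=
  | ComputesLeaf S f : (#|S| <= 1)%N -> depends S f -> computes 1 S f
  | ComputesAdd s1 s2 S f1 f2 :
      computes s1 S f1 -> computes s2 S f2 -> computes (s1 + s2) S (f1 \+ f2)
  | ComputesMul s1 s2 S1 S2 f1 f2 : [disjoint S1 & S2] ->
      computes s1 S1 f1 -> computes s2 S2 f2 ->
      computes (s1 + s2) (S1 :|: S2) (f1 \* f2)
  | ComputesWiden s t S T f : (s <= t)%N -> S \subset T ->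
      computes s S f -> computes t T f.

Lemma computes_gt0 s S f : computes s S f -> (0 < s)%N.
Proof. by elim=> // *; rewrite ?addn_gt0; lia. Qed.

Lemma computes_depends s S f : computes s S f -> depends S f.
Proof.
elim=> // {s S f}.
- by move=> s1 s2 S f1 f2 _ d1 _ d2 x y xy /=; rewrite (d1 x y) // (d2 x y).
- by move=> s1 s2 S1 S2 f1 f2 _ _ d1 _ d2; apply: dependsM.
- by move=> s t S T f _ sST _; apply: dependsS.
Qed.

Lemma computes_scale a s S f : computes s S f -> computes s S (fun x => a * f x).
Proof.
elim=> {s S f}.
- move=> S f S1 df; apply: ComputesLeaf => // x y xy.
  by rewrite (df x y).
- move=> s1 s2 S f1 f2 _ c1 _ c2.
  rewrite (_ : (fun _ => _) = (fun x => a * f1 x) \+ (fun x => a * f2 x)).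
    exact: ComputesAdd.
  by apply/funext => x /=; rewrite mulrDr.
- move=> s1 s2 S1 S2 f1 f2 dS _ c1 c2 _.
  rewrite (_ : (fun _ => _) = (fun x => a * f1 x) \* f2).
    exact: ComputesMul.
  by apply/funext => x /=; rewrite mulrA.
- by move=> s t S T f st sST _; apply: ComputesWiden.
Qed.

Definition restrict T x : bits n := [ffun i => x i && (i \in T)].

Lemma computes_restrict T s S f :
  computes s S f -> computes s (S :&: T) (f \o restrict T).
Proof.
elim=> {s S f}.
- move=> S f S1 df; apply: ComputesLeaf.
    exact: leq_trans (subset_leq_card (subsetIl _ _)) S1.
  move=> x y xy /=; apply: df => i iS; rewrite !ffunE.
  by case: (boolP (i \in T)) => iT; rewrite ?andbF ?xy // inE iS.
- by move=> s1 s2 S f1 f2 _ c1 _ c2; apply: ComputesAdd.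
- move=> s1 s2 S1 S2 f1 f2 dS _ c1 _ c2; rewrite setIUl.
  apply: ComputesMul => //; apply: disjointWl (subsetIl _ _) _.
  exact: disjointWr (subsetIl _ _) dS.
- by move=> s t S S' f st sST _; apply: ComputesWiden => //; apply: setSI.
Qed.

(** Setting the variables outside [T] to 0 leaves [f] unchanged and turns leaves into leaves, so the
    recorded variable set can be replaced at no cost. *)
Lemma computes_on T s S f : depends T f -> computes s S f -> computes s T f.
Proof.
move=> df /(computes_restrict T) cf.
rewrite (_ : f = f \o restrict T).
  by apply: ComputesWiden cf => //; apply: subsetIr.
by apply/funext => x; apply: df => i iT; rewrite ffunE iT andbT.
Qed.

(* The number s of terms is charged additively: a term costs its own s. *)
Inductive sum_of (P : nat -> (bits n -> K) -> Prop) : nat -> (bits n -> K) -> Prop :=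
  | SumOne s f : P s f -> sum_of P s f
  | SumAdd s1 s2 f1 f2 :
      sum_of P s1 f1 -> sum_of P s2 f2 -> sum_of P (s1 + s2) (f1 \+ f2).

Lemma sum_of_bind P Q s f :
  sum_of P s f -> (forall s f, P s f -> sum_of Q s f) -> sum_of Q s f.
Proof. by move=> + PQ; elim=> *; [exact: PQ | exact: SumAdd]. Qed.

Lemma sum_of_mulr P Q g s f : sum_of P s f ->
  (forall s f, P s f -> Q s (f \* g)) -> sum_of Q s (f \* g).
Proof.
move=> + PQ; elim=> [s' f' /PQ|s1 s2 f1 f2 _ c1 _ c2]; first exact: SumOne.
rewrite (_ : (f1 \+ f2) \* g = (f1 \* g) \+ (f2 \* g)); first exact: SumAdd.
by apply/funext => x /=; rewrite mulrDl.
Qed.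

Lemma sum_of_leq P s t f : (forall s t f, (s <= t)%N -> P s f -> P t f) ->
  (s <= t)%N -> sum_of P s f -> sum_of P t f.
Proof.
move=> Pm st sf; elim: sf t st => [s' f' Pf|s1 s2 f1 f2 c1 _ _ c2] t st.
  by apply: SumOne; apply: Pm Pf.
rewrite -(subnKC (leq_trans (leq_addr _ _) st)); apply: SumAdd => //.
by apply: c2; lia.
Qed.

(** Only [f] keeps the budget [s]; [g] is an arbitrary function of the other variables, since later
    rounds split [f] alone. *)
Definition split_term k U s h := exists V f g,
  [/\ V \subset U, (k < 2 * #|V|)%N, (#|V| <= k)%N, computes s V f
    & depends (U :\: V) g /\ h = f \* g].

Lemma split_term_leq k U s t h : (s <= t)%N -> split_term k U s h -> split_term k U t h.
Proof.
move=> st [V [f [g [VU kV Vk cf dg]]]]; exists V, f, g; split=> //.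
exact: ComputesWiden st (subxx _) cf.
Qed.

(** Additions distribute the budget. At a product, descend into the factor with more variables until
    it has at most [k]; it then has more than k/2, because the union has more than [k]. The leaves
    of the other factor are dropped. *)
Lemma computes_split k s U f : (0 < k < #|U|)%N -> computes s U f ->
  sum_of (split_term k U) s f.
Proof.
move=> /andP[k0 kU] cf; elim: cf kU => {s U f}.
- by move=> S f S1 _ kS; have := leq_trans kS S1; case: (k) k0.
- by move=> s1 s2 S f1 f2 _ c1 _ c2 kS; apply: SumAdd; [exact: c1 | exact: c2].
- have main s1 s2 S1 S2 f1 f2 : [disjoint S1 & S2] -> computes s1 S1 f1 ->
      ((k < #|S1|)%N -> sum_of (split_term k S1) s1 f1) -> computes s2 S2 f2 ->
      (#|S2| <= #|S1|)%N -> (k < #|S1 :|: S2|)%N ->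
      sum_of (split_term k (S1 :|: S2)) (s1 + s2) (f1 \* f2).
    move=> dS c1 i1 c2 S21 kS.
    have D : (S1 :|: S2) :\: S1 = S2.
      by rewrite setDUl setDv set0U; apply/setDidPl; rewrite disjoint_sym.
    apply: (sum_of_leq (@split_term_leq _ _) (leq_addr s2 s1)).
    have [kS1|S1k] := ltnP k #|S1|.
      apply: sum_of_mulr (i1 kS1) _ => s h [V [f [g [VU kV Vk cf [dg ->]]]]].
      exists V, f, (g \* f2); split=> //.
      - exact: subset_trans VU (subsetUl _ _).
      - split; last by apply/funext => x /=; rewrite mulrA.
        rewrite setDUl; apply: dependsM => //.
        apply: dependsS (computes_depends c2).
        by rewrite subsetD subxx disjoint_sym (disjointWl VU).
    apply: SumOne; exists S1, f1, f2; split=> //; first exact: subsetUl.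
      by apply: leq_trans kS _; rewrite mul2n -addnn cardsU; lia.
    by rewrite D; split=> //; apply: computes_depends c2.
  move=> s1 s2 S1 S2 f1 f2 dS c1 i1 c2 i2.
  have [S21|/ltnW S12] := leqP #|S2| #|S1|; first exact: main.
  rewrite setUC addnC (_ : f1 \* f2 = f2 \* f1).
    by apply: main; rewrite // disjoint_sym.
  by apply/funext => x /=; rewrite mulrC.
- move=> s t S T f st sST cf IH kT.
  apply: (sum_of_leq (@split_term_leq _ _) st).
  have [kS|Sk] := ltnP k #|S|.
    apply: sum_of_bind (IH kS) _ => s' h [V [f' [g [VU kV Vk cf' [dg ->]]]]].
    apply: SumOne; exists V, f', g; split=> //; first exact: subset_trans VU sST.
    by split=> //; apply: dependsS dg; apply: setSD.
  (* [S] may be too small, so it is padded to exactly [k] variables, with cofactor 1. *)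
  have [|V [SV VT cV]] := subset_between (k := k) sST; first by rewrite Sk ltnW.
  apply: SumOne; exists V, f, (fun=> 1); split=> //; rewrite ?cV //; first by lia.
    exact: ComputesWiden (leqnn s) SV cf.
  by split=> //; apply/funext => x /=; rewrite mulr1.
Qed.

Definition mix Y x y : bits n := [ffun i => if i \in Y then x i else y i].

(* The matrix of h has rows and columns indexed by all of {0,1}^n: a row ignores
   the bits outside Y and a column those in Y, which only repeats rows and
   columns and does not affect the rank. *)
Definition rank_le Y r h := exists (I : finType) (u v : I -> bits n -> K),
  (#|I| <= r)%N /\ forall x y, h (mix Y x y) = \sum_i u i x * v i y.

Lemma rank_le_leq Y r r' h : (r <= r')%N -> rank_le Y r h -> rank_le Y r' h.
Proof.
move=> rr' [I [u [v [Ir hE]]]]; exists I, u, v; split=> //.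
exact: leq_trans rr'.
Qed.

Lemma rank_leD Y r1 r2 h1 h2 :
  rank_le Y r1 h1 -> rank_le Y r2 h2 -> rank_le Y (r1 + r2) (h1 \+ h2).
Proof.
move=> [I1 [u1 [v1 [Ir1 h1E]]]] [I2 [u2 [v2 [Ir2 h2E]]]].
exists (I1 + I2)%type,
  (fun i => match i with inl i => u1 i | inr i => u2 i end),
  (fun i => match i with inl i => v1 i | inr i => v2 i end).
split=> [|x y]; first by rewrite card_sum leq_add.
by rewrite big_sumType /= h1E h2E.
Qed.

Lemma rank_leM Y r1 r2 h1 h2 :
  rank_le Y r1 h1 -> rank_le Y r2 h2 -> rank_le Y (r1 * r2) (h1 \* h2).
Proof.
move=> [I1 [u1 [v1 [Ir1 h1E]]]] [I2 [u2 [v2 [Ir2 h2E]]]].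
exists (I1 * I2)%type,
  (fun i x => u1 i.1 x * u2 i.2 x), (fun i y => v1 i.1 y * v2 i.2 y).
split=> [|x y]; first by rewrite card_prod leq_mul.
rewrite /= h1E h2E big_distrlr pair_big /=.
by apply: eq_bigr => i _; rewrite mulrACA.
Qed.

(** The bits in [U :&: Y] determine the row, so there is one rank-one term per assignment to them:
    its indicator times the corresponding row. *)
Lemma rank_le_left Y U h : depends U h -> rank_le Y (2 ^ #|U :&: Y|) h.
Proof.
move=> dh; set Z := U :&: Y.
pose I : finType := {A : {set 'I_n} | A \in powerset Z}.
exists I, (fun (A : I) x => (sval A == [set i in Z | x i])%:R),
  (fun (A : I) y => h (mix Y [ffun i => i \in sval A] y)).
split=> [|x y]; first by rewrite card_sig card_powerset.
have zP : [set i in Z | x i] \in powerset Z.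
  by rewrite inE; apply/subsetP => i; rewrite inE => /andP[].
rewrite (bigD1 (exist (fun A => A \in powerset Z) _ zP : I)) //= eqxx mul1r.
rewrite big1 ?addr0 => [|A].
  apply: dh => i iU; rewrite !ffunE !inE iU.
  by case: (i \in Y).
by rewrite -val_eqE /= => /negPf->; rewrite mul0r.
Qed.

Lemma rank_le_right Y U h : depends U h -> rank_le Y (2 ^ #|U :\: Y|) h.
Proof.
move=> /(rank_le_left (~: Y)) [I [u [v [Ir hE]]]].
exists I, v, u; split=> [|x y]; first by rewrite setDE.
rewrite (_ : mix Y x y = mix (~: Y) y x).
  by rewrite hE; apply: eq_bigr => i _; rewrite mulrC.
by apply/ffunP => i; rewrite !ffunE inE; case: (i \in Y).
Qed.

(** The hypothesis exhibits an identity submatrix of size [#|J|], which factors through dimension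
    [#|I|]. *)
Lemma leq_rank (J : finType) (a b : J -> bits n) Y r h :
  (forall i j, h (mix Y (a i) (b j)) = (i == j)%:R) -> rank_le Y r h ->
  (#|J| <= r)%N.
Proof.
move=> hJ [I [u [v [Ir hE]]]]; apply: leq_trans Ir.
pose M := \matrix_(i < #|J|, k < #|I|) u (enum_val k) (a (enum_val i)).
pose N := \matrix_(k < #|I|, j < #|J|) v (enum_val k) (b (enum_val j)).
rewrite -[leqLHS](mxrank1 K) (_ : 1%:M = M *m N); first exact: mulmx_max_rank.
apply/matrixP => i j; rewrite !mxE -(inj_eq enum_val_inj) -hJ hE.
rewrite (reindex_omap (enum_val : 'I_#|I| -> I) (fun i => Some (enum_rank i))).
  by apply: eq_big => [k|k _]; rewrite ?mxE ?enum_valK ?eqxx.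
by move=> k _; rewrite /= enum_rankK.
Qed.

Definition pairwise_disjoint (Ws : seq {set 'I_n}) :=
  pairwise (fun W1 W2 : {set 'I_n} => [disjoint W1 & W2]) Ws.

(** A form of Raz's log-products in which each block splits off separately: a single unbalanced
    block will bound the rank. Positivity of [s] lets a term pay for itself. *)
Definition log_product t w U s h := [/\ (0 < s)%N, depends U h
  & exists Ws : seq {set 'I_n},
  [/\ size Ws = t, pairwise_disjoint Ws,
      forall W, W \in Ws -> W \subset U /\ (w <= #|W|)%N
    & forall W, W \in Ws -> exists f g,
        [/\ depends W f, depends (U :\: W) g & h = f \* g]]].

(** In each round the cofactor's variables [U :\: V], at least half of [U], become a new block, and
    [V] keeps at least a quarter of [U] for the later rounds, whence the powers of 4. *)
Lemma computes_log_product t w s U f : (0 < w)%N -> (4 ^ t * w <= #|U|)%N ->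
  computes s U f -> sum_of (log_product t w U) s f.
Proof.
move=> w0; elim: t s U f => [|t IH] s U f tU cf.
  apply: SumOne; split; [exact: computes_gt0 cf | exact: computes_depends cf |].
  by exists [::].
have U4 : (4 <= #|U|)%N by apply: leq_trans tU; rewrite expnS; lia.
have kU : (0 < #|U|./2 < #|U|)%N by lia.
apply: sum_of_bind (computes_split kU cf) _ => {cf kU}{}s {}f
  [V [f' [g [VU kV Vk cf' [dg ->]]]]].
have tV : (4 ^ t * w <= #|V|)%N.
  by move: tU; rewrite expnS -mulnA; lia.
apply: sum_of_mulr (IH _ _ _ tV cf') _ => {IH cf'}{}s h
  [s0 dh [Ws [szW dW sW fW]]].
have wV : (w <= #|V|)%N by apply: leq_trans tV; rewrite leq_pmull ?expn_gt0.
have UDV : U :\: (U :\: V) = V by rewrite setDDr setDv set0U; apply/setIidPr.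
split=> //.
  by apply: dependsS (dependsM dh dg); rewrite subUset VU subsetDl.
exists (U :\: V :: Ws); split=> /=.
- by rewrite szW.
- rewrite /pairwise_disjoint /= -/(pairwise_disjoint Ws) dW andbT.
  apply/allP => W /sW [WV _].
  by rewrite (disjointWr WV) // -setI_eq0 setDE -setIA (setIC _ V) setICr setI0.
- move=> W; rewrite inE => /predU1P[->|/sW[WV Ww]]; last first.
    by split=> //; apply: subset_trans VU.
  by split; [exact: subsetDl | rewrite cardsDS //; lia].
- move=> W; rewrite inE => /predU1P[->|WWs].
    exists g, h; rewrite UDV; split=> //.
    by apply/funext => x /=; rewrite mulrC.
  have [a [b [da db ->]]] := fW W WWs; have [WV _] := sW W WWs.
  exists a, (b \* g); split=> //; last by apply/funext => x /=; rewrite mulrA.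
  apply: dependsS (dependsM db dg); by rewrite subUset setSD // setDS.
Qed.
End Computation.

(** * Anti-concentration of random partitions *)

Lemma mul_central_binS m :
  (m.+1 * 'C(m.+1.*2, m.+1) = 2 * m.*2.+1 * 'C(m.*2, m))%N.
Proof.
have e1 := mul_bin_diag m.*2.+1 m; rewrite /= in e1.
have e2 : ('C(m.*2.+1, m) = 'C(m.*2.+1, m.+1))%N.
  by rewrite -[in RHS]bin_sub; [congr 'C(_, _); lia | lia].
rewrite doubleS binS e2; nia.
Qed.

(** This is the bound 4^m / sqrt(2m+1), squared to stay in the integers; the induction rests on
    (2m+1)(2m+3) <= (2m+2)^2. *)
Lemma central_bin_le m : ('C(m.*2, m) ^ 2 * m.*2.+1 <= 16 ^ m)%N.
Proof.
elim: m => [|m IH]; first by rewrite bin0.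
have e := mul_central_binS m.
rewrite -(leq_pmul2l (m := m.+1 ^ 2)) ?expn_gt0 // mulnA -expnMn e.
set c := 'C(_, _) in IH *; clear e.
apply: leq_trans (_ : 4 * (m.*2.+1 * m.*2.+3) * (c ^ 2 * m.*2.+1) <= _)%N.
  by rewrite -!mulnn doubleS; lia.
rewrite (expnS 16) [leqRHS]mulnA leq_mul // -mulnn; lia.
Qed.

(** Bounds the cost of conditioning a uniform subset of 2m points on having size m. *)
Lemma leq_central_bin m : (4 ^ m <= m.*2.+1 * 'C(m.*2, m))%N.
Proof.
elim: m => [|m IH]; first by rewrite bin0.
have e := mul_central_binS m.
rewrite expnS doubleS.
apply: leq_trans (_ : 2 * (m.+1 * 'C(m.+1.*2, m.+1)) <= _)%N.
  by rewrite e; nia.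
by rewrite doubleS mulnA leq_mul //; nia.
Qed.

(* The square is one term of Vandermonde's sum for C(2r, r). *)
Lemma bin_sqr_le r j : ('C(r, j) ^ 2 <= 'C(r.*2, r))%N.
Proof.
have [jr|rj] := leqP j r; last by rewrite bin_small.
rewrite -addnn -binomial.Vandermonde.
have jr' : (j < r.+1)%N by [].
rewrite (bigD1 (Ordinal jr')) //= bin_sub // -mulnn.
exact: leq_addr.
Qed.

(** Fourth powers reduce this to the two bounds above: the coefficient is at most 2^r / r^(1/4), and
    r^(1/4) >= 2^(2a). *)
Lemma bin_le r j a : (2 ^ (8 * a) <= r)%N -> ('C(r, j) * 2 ^ (2 * a) <= 2 ^ r)%N.
Proof.
move=> ar; rewrite -(leq_exp2r _ _ (isT : 0 < 4)%N).
apply: leq_trans (_ : 'C(r.*2, r) ^ 2 * r.*2.+1 <= _)%N.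
  rewrite expnMn -expnM (_ : 2 * a * 4 = 8 * a)%N; last by lia.
  rewrite (expnM _ 2 2); apply: leq_mul; first by rewrite leq_exp2r // bin_sqr_le.
  lia.
by apply: leq_trans (central_bin_le r) _; rewrite -[16%N]/(2 ^ 4)%N -!expnM mulnC.
Qed.

Lemma leq_card_bigcup (T I : finType) (P : pred I) (F : I -> {set T}) :
  (#|\bigcup_(i | P i) F i| <= \sum_(i | P i) #|F i|)%N.
Proof.
elim/big_rec2: _ => [|i k A _ kA]; first by rewrite cards0.
by rewrite cardsU (leq_trans (leq_subr _ _)) // leq_add2l.
Qed.

Section Balance.
Variable n : nat.
Implicit Types W Y A : {set 'I_n}.

(* | |W :&: Y| - |W :\: Y| | < k, without subtraction. *)
Definition balanced k W Y :=
  (#|W| < 2 * #|W :&: Y| + k)%N && (2 * #|W :&: Y| < #|W| + k)%N.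

Lemma card_balanced a W : (2 ^ (8 * a) <= #|W|)%N ->
  (#|[set Y in powerset W | balanced (2 ^ a) W Y]| * 2 ^ a <= 2 ^ #|W|)%N.
Proof.
move=> aW; set k := (2 ^ a)%N; have k0 : (0 < k)%N by rewrite expn_gt0.
set B := [set Y in _ | _].
(* Balance confines the size to the [k] values from [lo] on; each has probability at most 2^(-2a) by
   [bin_le], and k = 2^a. *)
pose lo := (#|W|.+1 - k).+1./2.
have cB : (#|B| <= \sum_(i < k) 'C(#|W|, lo + i))%N.
  pose D i := [set A : {set 'I_n} | A \subset W & #|A| == (lo + i)%N].
  apply: leq_trans (_ : #|\bigcup_(i < k) D i| <= _)%N.
    apply/subset_leq_card/subsetP => Y; rewrite !inE => /andP[YW].
    rewrite /balanced (setIidPr YW) => /andP[l1 l2].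
    have loY : (lo <= #|Y|)%N by rewrite /lo; lia.
    have ik : (#|Y| - lo < k)%N by rewrite /lo; lia.
    by apply/bigcupP; exists (Ordinal ik) => //; rewrite inE YW /= subnKC.
  apply: leq_trans (leq_card_bigcup _ _) _.
  by apply: leq_sum => i _; rewrite cards_draws.
rewrite -(leq_pmul2r (m := k)) ?expn_gt0 // -mulnA.
apply: leq_trans (leq_mul cB (leqnn _)) _.
rewrite big_distrl /=.
apply: leq_trans (_ : \sum_(i < k) 2 ^ #|W| <= _)%N.
  apply: leq_sum => i _; rewrite /k -expnD addnn -mul2n.
  exact: bin_le.
by rewrite sum_nat_const card_ord mulnC.
Qed.

(* The restrictions of a uniform subset to W and to the complement of W are
   independent. *)
Lemma card_independent W (P Q : pred {set 'I_n}) :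
  (forall Y, P (W :&: Y) = P Y) -> (forall Y, Q (Y :\: W) = Q Y) ->
  (#|[set Y | P Y && Q Y]| * 2 ^ #|W| <=
    #|[set Y in powerset W | P Y]| * #|[set Y | Q Y]|)%N.
Proof.
move=> PW QW; rewrite -card_powerset -!cardsX.
(* [F] records [W :&: Y] and replaces the part of [Y] inside [W] by the free subset [A] of [W]; both
   [Y] and [A] can be recovered. *)
pose F (p : {set 'I_n} * {set 'I_n}) := (W :&: p.1, p.2 :|: (p.1 :\: W)).
rewrite -(card_in_imset (f := F)); last first.
  move=> [Y A] [Y' A']; rewrite !inE /= => /andP[_ AW] /andP[_ AW'] [e1 e2].
  have e3 : Y :\: W = Y' :\: W.
    have := congr1 (fun B => B :\: W) e2; rewrite !setDUl !setDDl !setUid.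
    have [-> ->] : A :\: W = set0 /\ A' :\: W = set0 by split; apply/eqP; rewrite setD_eq0.
    by rewrite !set0U.
  congr pair; first by rewrite -(setID Y W) -(setID Y' W) e3 !(setIC _ W) e1.
  have := congr1 (fun B => W :&: B) e2; rewrite !setIUr.
  rewrite (setIidPr AW) (setIidPr AW').
  by rewrite !setIDA !(setIC W) -!setIDA !setDv !setI0 !setU0.
apply/subset_leq_card/subsetP => p /imsetP[[Y A]]; rewrite !inE /=.
move=> /andP[/andP[PY QY] AW] ->; rewrite /= subsetIl PW PY /=.
rewrite -QW setDUl setDDl setUid (eqP (_ : A :\: W == set0)) ?setD_eq0 // set0U.
by rewrite QW.
Qed.

(** By disjointness, balance of the later blocks is decided by [Y :\: W] and that of [W] by
    [W :&: Y], so the probabilities multiply. *)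
Lemma card_all_balanced a (Ws : seq {set 'I_n}) :
  pairwise_disjoint Ws -> (forall W, W \in Ws -> 2 ^ (8 * a) <= #|W|)%N ->
  (#|[set Y | all (balanced (2 ^ a) ^~ Y) Ws]| * 2 ^ (a * size Ws) <= 2 ^ n)%N.
Proof.
elim: Ws => [_ _|W Ws IH /= /andP[dW dWs] sW].
  rewrite muln0 muln1 (_ : [set Y | _] = powerset [set: 'I_n]).
    by rewrite card_powerset cardsT card_ord.
  by apply/setP => Y; rewrite !inE subsetT.
have {}IH := IH dWs (fun V VWs => sW V (mem_behead (s := W :: Ws) VWs)).
have cW := card_balanced (sW W (mem_head W Ws)).
rewrite mulnS expnD.
have := @card_independent W (balanced (2 ^ a) W)
  (fun Y => all (balanced (2 ^ a) ^~ Y) Ws).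
rewrite /= => /(_ _ _)/wrap[].
- by move=> Y; rewrite /balanced setIA setIid.
- move=> Y; apply: eq_in_all => V VWs; rewrite /balanced.
  rewrite setIDA; have /setDidPl -> // : [disjoint V :&: Y & W].
  apply: disjointWl (subsetIl _ _) _; rewrite disjoint_sym.
  exact: (allP dW).
move=> ind.
rewrite -(leq_pmul2r (m := 2 ^ #|W|)) ?expn_gt0 //.
rewrite mulnAC (leq_trans (leq_mul ind (leqnn _))) // mulnACA.
by rewrite [leqRHS]mulnC leq_mul.
Qed.

Lemma log_product_rank (K : fieldType) a t m s h :
  n = m.*2 -> @log_product n K t (2 ^ (8 * a)) [set: 'I_n] s h ->
  exists B : {set {set 'I_n}}, (#|B| * 2 ^ (a * t) <= 2 ^ n)%N /\
    forall Y, #|Y| = m -> Y \notin B -> rank_le Y (2 ^ (m - 2 ^ a)) h.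
Proof.
move=> nm [s0 _ [Ws [<- dW sW fW]]].
exists [set Y | all (balanced (2 ^ a) ^~ Y) Ws]; split.
  by apply: card_all_balanced => // W /sW[].
move=> Y Ym; rewrite inE => /allPn[W WWs].
have [f [g [df dg ->]]] := fW W WWs.
have cI := cardsID Y W; have cI' := cardsID W Y.
have cU := cardsID W (~: Y); have cT := cardsC Y; rewrite card_ord in cT.
rewrite (setIC Y) in cI'; rewrite (setIC (~: Y)) -setDE in cU.
rewrite /balanced negb_and -!leqNgt => /orP[ub|ub].
(* Few bits of [W] lie in [Y]: count rows for [f] and columns for [g]. The exponent m + [#|W :&: Y|]
   - [#|W :\: Y|] is at most m - 2^a. The other case exchanges the roles. *)
- apply: rank_le_leq (rank_leM (rank_le_left Y df) (rank_le_right Y dg)).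
  rewrite -expnD leq_exp2l // setTD (_ : ~: W :\: Y = ~: Y :\: W); first by lia.
  by rewrite !setDE setIC.
- rewrite (_ : f \* g = g \* f); last by apply/funext => x /=; rewrite mulrC.
  apply: rank_le_leq (rank_leM (rank_le_left Y dg) (rank_le_right Y df)).
  by rewrite -expnD leq_exp2l // setTD (setIC _ Y) -setDE; lia.
Qed.

(** Exceptional sets unite and ranks add, so both bounds are linear in the additive budget [s]. *)
Lemma sum_of_log_product_rank (K : fieldType) a t m s f :
  n = m.*2 -> sum_of (@log_product n K t (2 ^ (8 * a)) [set: 'I_n]) s f ->
  exists B : {set {set 'I_n}}, (#|B| * 2 ^ (a * t) <= s * 2 ^ n)%N /\
    forall Y, #|Y| = m -> Y \notin B -> rank_le Y (s * 2 ^ (m - 2 ^ a)) f.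
Proof.
move=> nm; elim=> {s f}[s f Lf|s1 s2 f1 f2 _ [B1 [c1 r1]] _ [B2 [c2 r2]]].
  have [B [cB rB]] := log_product_rank nm Lf.
  have s0 : (0 < s)%N by case: Lf.
  exists B; split=> [|Y Ym YB]; first by apply: leq_trans cB _; rewrite leq_pmull.
  by apply: rank_le_leq (rB Y Ym YB); rewrite leq_pmull.
exists (B1 :|: B2); split.
  rewrite mulnDl; apply: leq_trans (leq_add c1 c2).
  by rewrite -mulnDl leq_mul // cardsU leq_subr.
move=> Y Ym; rewrite inE negb_or mulnDl => /andP[YB1 YB2].
by apply: rank_leD; [apply: r1 | apply: r2].
Qed.

Lemma computes_rank (K : fieldType) a m s (f : bits n -> K) :
  n = m.*2 -> (2 ^ (16 * a) <= n)%N -> computes s [set: 'I_n] f ->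
  exists B : {set {set 'I_n}}, (#|B| * 2 ^ (4 * a ^ 2) <= s * 2 ^ n)%N /\
    forall Y, #|Y| = m -> Y \notin B -> rank_le Y (s * 2 ^ (m - 2 ^ a)) f.
Proof.
move=> nm an cf.
(* The 4a rounds shrink the variable set by 4^(4a) = 2^(8a) and must leave room for a block of size
   2^(8a): hence the 16. *)
have tU : (4 ^ (4 * a) * 2 ^ (8 * a) <= #|[set: 'I_n]|)%N.
  rewrite cardsT card_ord -[X in (X ^ _)%N]/(2 ^ 2)%N -expnM -expnD.
  by rewrite (_ : 2 * (4 * a) + 8 * a = 16 * a)%N //; lia.
rewrite -mulnn mulnCA; apply: sum_of_log_product_rank => //.
by apply: computes_log_product tU cf; rewrite expn_gt0.
Qed.

End Balance.

(** * The kernel of a random matrix *)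

Lemma leq_card_fibers (T W : finType) (D : {set T}) (g : T -> W) q :
  (forall w, #|[set x in D | g x == w]| <= q)%N -> (#|D| <= #|g @: D| * q)%N.
Proof.
move=> Dq; rewrite -sum1_card (partition_big_imset g) /= -sum_nat_const.
apply: leq_sum => w _; rewrite sum1_card; apply: leq_trans (Dq w).
by apply: subset_leq_card; apply/subsetP => x; rewrite !inE.
Qed.

(** With [u *m v = 1], adding [w *m u] changes the product with [v] from 0 to [w], so the translates
    for distinct [w] are disjoint. *)
Lemma card_mul_eq0 (F : finFieldType) m n (v : 'cV[F]_n) : v != 0 ->
  (#|[set A : 'M[F]_(m, n) | A *m v == 0%R]| * #|F| ^ m <= #|{: 'M[F]_(m, n)}|)%N.
Proof.
move=> /cV0Pn[i vi].
pose u := (v i 0)^-1 *: delta_mx 0 i : 'rV[F]_n.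
have uv : u *m v = 1%:M.
  apply/matrixP => j k; rewrite !ord1 -scalemxAl -rowE !mxE /=.
  by rewrite mulVf.
have <- : #|[set: 'cV[F]_m]| = (#|F| ^ m)%N by rewrite cardsT card_mx muln1.
rewrite -cardsX -cardsT.
rewrite -(card_in_imset (f := fun p : 'M[F]_(m, n) * 'cV[F]_m => p.1 + p.2 *m u)).
  exact/subset_leq_card/subsetT.
move=> [A w] [A' w']; rewrite !inE !andbT /= => /eqP Av /eqP Av' e.
have ww : w = w'.
  have := congr1 (mulmx^~ v) e; rewrite !mulmxDl Av Av' !add0r -!mulmxA uv.
  by rewrite !mulmx1.
by move: e; rewrite ww => /addIr->.
Qed.

Section Coset.
Variables (m n : nat).
Implicit Types (A : 'M['F_2]_(m, n)) (x y : bits n) (Y : {set 'I_n}).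

Definition vec x : 'cV['F_2]_n := \col_i (x i)%:R.

Definition xor x y : bits n := [ffun i => x i (+) y i].

Lemma vec_xor x y : vec (xor x y) = vec x - vec y.
Proof.
by apply/matrixP => i j; rewrite !mxE !ffunE; case: (x i); case: (y i); apply/val_inj.
Qed.

Lemma vec_inj : injective vec.
Proof.
move=> x y /matrixP e; apply/ffunP => i.
by have := e i 0; rewrite !mxE; case: (x i); case: (y i).
Qed.

Lemma vec_mix Y x y : vec (mix Y x y) = vec (restrict Y x) + vec (restrict (~: Y) y).
Proof.
apply/matrixP => i j; rewrite !mxE !ffunE inE.
by case: (i \in Y); rewrite ?andbT ?andbF ?addr0 ?add0r.
Qed.

Lemma vec_restrict Y x : vec x = vec (restrict Y x) + vec (restrict (~: Y) x).
Proof. by rewrite -vec_mix; congr vec; apply/ffunP => i; rewrite ffunE if_same. Qed.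

(** The kernel of the columns of [A] indexed by [Y], its vectors extended by zero. *)
Definition block_kernel A Y : {set bits n} :=
  [set x in kernel_set A | restrict Y x == x].

Lemma restrict_xor Y x y : restrict Y (xor x y) = xor (restrict Y x) (restrict Y y).
Proof. by apply/ffunP => i; rewrite !ffunE; case: (i \in Y); rewrite ?andbT ?andbF. Qed.

Lemma restrict_id Y x : restrict Y (restrict Y x) = restrict Y x.
Proof. by apply/ffunP => i; rewrite !ffunE -andbA andbb. Qed.

Lemma xorK y : injective (xor^~ y).
Proof.
by move=> x x' /ffunP e; apply/ffunP => i; have := e i; rewrite !ffunE => /addIb.
Qed.

Lemma in_kernel A x : (x \in kernel_set A) = (A *m vec x == 0).
Proof. by rewrite inE. Qed.

Lemma leq_card_kernel A : (2 ^ n <= 2 ^ m * #|kernel_set A|)%N.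
Proof.
have <- : #|[set: bits n]| = (2 ^ n)%N.
  by rewrite cardsT card_ffun card_bool card_ord.
apply: leq_trans (leq_card_fibers (g := fun x => A *m vec x) (q := #|kernel_set A|) _) _.
  move=> w; have [->|[x0]] := set_0Vmem [set x in [set: bits n] | A *m vec x == w].
    by rewrite cards0.
  rewrite !inE /= => /eqP x0w.
  rewrite -(card_imset _ (@xorK x0)); apply/subset_leq_card/subsetP => _ /imsetP[x + ->].
  rewrite !inE /= => /eqP xw.
  by rewrite -/(vec _) vec_xor mulmxBr x0w xw subrr.
rewrite leq_mul2r; apply/orP; right; apply: leq_trans (max_card _) _.
by rewrite card_mx muln1 card_Fp.
Qed.

(** Group the kernel by the value [g x] of the part on [Y]. Elements of equal value differ by a pair
    from the two block kernels; representatives of distinct values index an identity submatrix, as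
    mixing two of them stays in the kernel only if their values agree. *)
Lemma kernel_rank (R : realType) A Y r :
  rank_le Y r (indicator R (kernel_set A)) ->
  (2 ^ n <= 2 ^ m * (r * (#|block_kernel A Y| * #|block_kernel A (~: Y)|)))%N.
Proof.
move=> rY; apply: leq_trans (leq_card_kernel A) _; rewrite leq_mul2l; apply/orP; right.
pose g x := A *m vec (restrict Y x).
have gC x : x \in kernel_set A -> A *m vec (restrict (~: Y) x) = - g x.
  rewrite in_kernel (vec_restrict Y) mulmxDr addrC addr_eq0 => /eqP->.
  by [].
apply: leq_trans (leq_card_fibers (g := g)
  (q := (#|block_kernel A Y| * #|block_kernel A (~: Y)|)%N) _) _.
  move=> w; have [->|[x0]] := set_0Vmem [set x in kernel_set A | g x == w].
    by rewrite cards0.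
  rewrite inE => /andP[x0S /eqP x0w].
  rewrite -cardsX.
  pose F x := (restrict Y (xor x x0), restrict (~: Y) (xor x x0)).
  rewrite -(card_imset _ (f := F)).
    apply/subset_leq_card/subsetP => _ /imsetP[x + ->].
    rewrite inE => /andP[xS /eqP xw].
    rewrite !inE /= !restrict_id !eqxx !andbT -!/(vec _) !restrict_xor !vec_xor.
    by rewrite !mulmxBr !gC // -!/(g _) x0w xw !subrr eqxx.
  move=> x x' [e1 e2]; apply: (@xorK x0); apply: vec_inj.
  by rewrite (vec_restrict Y) [RHS](vec_restrict Y) e1 e2.
rewrite leq_mul2r; apply/orP; right.
pose J : finType := {w | w \in g @: kernel_set A}.
have aP (w : J) : exists x, (x \in kernel_set A) && (g x == sval w).
  by case: w => w /= /imsetP[x xS ->]; exists x; rewrite xS eqxx.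
pose a w := xchoose (aP w).
have aS w : a w \in kernel_set A by have /andP[] := xchooseP (aP w).
have ga w : g (a w) = sval w by have /andP[_ /eqP] := xchooseP (aP w).
rewrite -[leqLHS]card_sig; apply: (@leq_rank _ _ J a a _ _ _ _ rY) => w w'.
rewrite /indicator in_kernel vec_mix mulmxDr gC // -/(g _) !ga subr_eq0.
by rewrite -val_eqE.
Qed.

Lemma card_supported Y : (#|[set x : bits n | restrict Y x == x]| <= 2 ^ #|Y|)%N.
Proof.
rewrite -card_powerset -(card_imset _ (f := fun x => [set i | x i])).
  apply/subset_leq_card/subsetP => _ /imsetP[x + ->].
  rewrite !inE => /eqP/ffunP xY; apply/subsetP => i; rewrite inE -xY ffunE.
  by case/andP.
by move=> x y /setP e; apply/ffunP => i; have := e i; rewrite !inE.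
Qed.

(** Exchange the sums: the zero vector is in every kernel, and each of the fewer than 2^m other
    vectors supported on [Y] is killed by at most a 2^(-m) fraction of the matrices. *)
Lemma sum_block_kernel Y : #|Y| = m ->
  (\sum_A #|block_kernel A Y| <= 2 * #|{: 'M['F_2]_(m, n)}|)%N.
Proof.
move=> Ym; set M := #|_|.
have -> : (\sum_(A : 'M['F_2]_(m, n)) #|block_kernel A Y| =
    \sum_(x | restrict Y x == x) #|[set A : 'M['F_2]_(m, n) | x \in kernel_set A]|)%N.
  under [LHS]eq_bigr => A _ do rewrite -sum1_card big_mkcond /=.
  rewrite [LHS]exchange_big /= [RHS]big_mkcond /=; apply: eq_bigr => x _.
  case: ifP => xY; last by rewrite big1 // => A _; rewrite !inE xY andbF.
  rewrite -sum1_card [RHS]big_mkcond /=; apply: eq_bigr => A _.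
  by rewrite !inE xY andbT.
rewrite -(leq_pmul2r (m := 2 ^ m)) ?expn_gt0 //.
pose x0 : bits n := [ffun=> false].
have x0Y : restrict Y x0 == x0 by apply/eqP/ffunP => i; rewrite !ffunE.
rewrite (bigD1 x0) //= mulnDl mul2n -addnn mulnDl leq_add //.
  by rewrite leq_mul2r max_card orbT.
rewrite big_distrl /= [leqRHS]mulnC.
apply: leq_trans (_ : \sum_(x | (restrict Y x == x) && (x != x0)) M <= _)%N.
  apply: leq_sum => x /andP[_ xn0].
  have vx : vec x != 0.
    apply: contraNneq xn0 => e; apply/eqP/vec_inj; rewrite e.
    by apply/matrixP => i j; rewrite !mxE ffunE.
  have := card_mul_eq0 m vx; rewrite card_Fp //; apply: leq_trans.
  rewrite leq_mul2r; apply/orP; right.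
  by apply/subset_leq_card/subsetP => A; rewrite !inE.
rewrite sum_nat_const leq_mul2r; apply/orP; right.
rewrite -[X in (_ <= 2 ^ X)%N]Ym; apply: leq_trans (card_supported Y).
by apply/subset_leq_card/subsetP => x; rewrite !inE => /andP[].
Qed.

Definition half_sets : {set {set 'I_n}} := [set Y : {set 'I_n} | #|Y| == m].

(** A sum in place of the product from the rank bound: expectations add, and AM-GM recovers the
    product. *)
Definition kernel_mass A Y := (#|block_kernel A Y| + #|block_kernel A (~: Y)|)%N.

(** The average mass is at most 4, so Markov's inequality at 8 keeps half of the matrices; a second
    use over [Y] gives the threshold 16. *)
Definition typical : {set 'M['F_2]_(m, n)} :=
  [set A | \sum_(Y in half_sets) kernel_mass A Y <= 8 * #|half_sets|]%N.

Lemma card_half_sets : #|half_sets| = 'C(n, m).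
Proof. by rewrite card_draws card_ord. Qed.

Lemma card_typical : n = m.*2 -> (#|{: 'M['F_2]_(m, n)}| <= 2 * #|typical|)%N.
Proof.
move=> nm; set M := #|{: 'M['F_2]_(m, n)}|; set b := #|half_sets|.
have b0 : (0 < b)%N by rewrite /b card_half_sets bin_gt0; lia.
have total : (\sum_A \sum_(Y in half_sets) kernel_mass A Y <= 4 * M * b)%N.
  rewrite exchange_big /= mulnC -sum_nat_const.
  apply: leq_sum => Y; rewrite inE => /eqP Ym.
  have cY : #|~: Y| = m by have := cardsC Y; rewrite card_ord; lia.
  rewrite big_split /=.
  apply: leq_trans (leq_add (sum_block_kernel Ym) (sum_block_kernel cY)) _.
  by rewrite -mulnDl.
have : (8 * b * #|~: typical| <= 4 * M * b)%N.
  apply: leq_trans total; rewrite (bigID (mem typical)) /= mulnC -sum_nat_const.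
  apply: leq_trans (leq_addl _ _); rewrite [leqRHS](eq_bigl (mem (~: typical))).
    by apply: leq_sum => A; rewrite !inE -ltnNge => /ltnW.
  by move=> A; rewrite !inE.
have : (#|typical| + #|~: typical| = M)%N by rewrite cardsC.
move=> <- h.
have : (8 * #|~: typical| <= 4 * (#|typical| + #|~: typical|))%N.
  by rewrite -(leq_pmul2r b0) mulnAC.
lia.
Qed.

Lemma typical_half A : A \in typical ->
  (2 * #|[set Y in half_sets | 16 < kernel_mass A Y]| <= #|half_sets|)%N.
Proof.
rewrite inE => tA; rewrite -(leq_pmul2l (m := 8)) //; apply: leq_trans tA.
rewrite mulnA (bigID (fun Y => 16 < kernel_mass A Y)%N) /=.
apply: leq_trans (leq_addr _ _); rewrite mulnC -sum_nat_const.
rewrite [leqRHS](eq_bigl (mem [set Y in half_sets | 16 < kernel_mass A Y]%N)).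
  by apply: leq_sum => Y; rewrite inE => /andP[_ /ltnW].
by move=> Y; rewrite !inE.
Qed.

(** The 6 absorbs the bound 64 on the product of the two kernel sizes. *)
Lemma leq_sqr_exp2 a : (7 <= a)%N -> (a ^ 2 + 6 <= 2 ^ a)%N.
Proof.
move=> a7; rewrite -(subnK a7); elim: (a - 7)%N => [|k IH]; first by [].
by rewrite addSn (expnS 2); move: IH; rewrite -!mulnn; nia.
Qed.

Lemma computes_typical (R : realType) a s A : n = m.*2 -> (7 <= a)%N ->
  (2 ^ (16 * a) <= n < 2 ^ (16 * a.+1))%N -> A \in typical ->
  computes s [set: 'I_n] (indicator R (kernel_set A)) -> (2 ^ a ^ 2 <= s)%N.
Proof.
move=> nm a7 /andP[an na] tA cS; rewrite leqNgt; apply/negP => sa.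
have [B [cB rB]] := computes_rank nm an cS.
(* The factor [n.+1] passes from all subsets to the half sets. The slack 2^(3a^2) has to exceed it:
   16(a+1) + 1 <= 3a^2 first holds at a = 7. *)
have hB : (2 * #|B| < #|half_sets|)%N.
  rewrite -(ltn_pmul2l (m := n.+1)) //.
  apply: (@leq_trans (2 ^ n)); last first.
    by rewrite card_half_sets nm -mul2n expnM -[(2 ^ 2)%N]/4%N mul2n leq_central_bin.
  have := leq_ltn_trans cB (_ : _ < 2 ^ a ^ 2 * 2 ^ n)%N.
  rewrite ltn_pmul2r ?expn_gt0 // => /(_ sa).
  rewrite (_ : 4 * a ^ 2 = 3 * a ^ 2 + a ^ 2)%N; last by lia.
  rewrite expnD mulnA [ltnRHS]mulnC ltn_pmul2r ?expn_gt0 //; apply: leq_ltn_trans.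
  rewrite mulnA mulnC leq_mul2l; apply/orP; right.
  apply: (@leq_trans (2 ^ (16 * a.+1) * 2)); first by rewrite leq_mul2r na orbT.
  by rewrite -expnSr leq_exp2l //; move: a7; rewrite -mulnn; nia.
have hH := typical_half tA.
(* Fewer than half and at most half of the half sets are excluded, so one remains. *)
have [Y] : exists Y, [&& Y \in half_sets, Y \notin B & (kernel_mass A Y <= 16)%N].
  apply/existsP; apply: contraLR hB; rewrite negb_exists => /forallP none.
  have : half_sets \subset B :|: [set Y in half_sets | 16 < kernel_mass A Y]%N.
    apply/subsetP => Y HY; have := none Y; rewrite HY /= negb_and negbK -ltnNge.
    by move: HY; rewrite !inE => ->.
  move=> /subset_leq_card; rewrite cardsU.
  lia.
rewrite inE => /and3P[/eqP Ym YB mass].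
have := kernel_rank (rB Y Ym YB).
set k1 := #|_|; set k2 := #|_|.
have k12 : (k1 * k2 <= 64)%N.
  rewrite -(leq_pmul2l (m := 4)) //; apply: leq_trans (leq_of_leqif (nat_AGM2 _ _)) _.
  by rewrite -[(4 * 64)%N]/(16 ^ 2)%N leq_exp2r.
(* Makes the truncated subtraction [m - 2 ^ a] exact. *)
have am : (2 ^ a <= m)%N.
  have : (2 ^ a.+1 <= n)%N by apply: leq_trans an; rewrite leq_exp2l //; lia.
  by rewrite nm expnS; lia.
apply/negP; rewrite -ltnNge nm -addnn expnD ltn_pmul2l ?expn_gt0 //.
apply: leq_ltn_trans (leq_mul (leqnn _) k12) _.
have -> : (2 ^ m = 2 ^ 2 ^ a * 2 ^ (m - 2 ^ a))%N by rewrite -expnD subnKC.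
rewrite mulnAC ltn_pmul2r ?expn_gt0 //.
apply: leq_trans (_ : 2 ^ a ^ 2 * 2 ^ 6 <= _)%N; first by rewrite ltn_pmul2r.
by rewrite -expnD leq_exp2l // leq_sqr_exp2.
Qed.

End Coset.

(** * Multilinear formulas *)

Section Formulas.
Variables (R : realType) (n : nat).
Local Notation C := (R[i]).
Local Notation MP := (mpoly n C).
Local Notation X i := (mpolyX C (mnm1 i)).
Implicit Types (p q : MP) (S T : {set 'I_n}).

Definition point (x : bits n) : 'I_n -> C := fun i => (x i)%:R.

(** In characteristic 0 these are the variables occurring in [p]; the derivative form lets Leibniz'
    rule handle products. *)
Definition pvars p : {set 'I_n} := [set i | mderiv i p != 0].

Lemma multilinear_mderiv2 p i : multilinear p -> mderiv i (mderiv i p) = 0.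
Proof.
move=> lp; apply/mpolyP => m; rewrite !mcoeff_mderiv mcoeff0.
rewrite memN_msupp_eq0 ?mul0rn //; apply: contraTN isT => /lp/(_ i).
by rewrite !mnmDE !mnm1E eqxx; lia.
Qed.

Lemma msupp_pvars p m i : m \in msupp p -> (0 < m i)%N -> i \in pvars p.
Proof.
move=> mp mi; rewrite inE; apply: contraTneq mp => /mpolyP/(_ (mnm_sub m (mnm1 i))).
rewrite mcoeff_mderiv mcoeff0 submK ?lep1mP -?lt0n //.
  by move=> /eqP; rewrite mulrn_eq0 /= mcoeff_eq0.
Qed.

Lemma meval_depends p : depends (pvars p) (fun x => meval (point x) p).
Proof.
move=> x y xy; rewrite !mevalE; apply: eq_big_seq => m mp; congr (_ * _).
apply: eq_bigr => i _; have [->|mi] := posnP (m i); first by rewrite !expr0.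
by rewrite /point xy // (msupp_pvars mp).
Qed.

(* Differentiating p * q twice in a common variable leaves 2 p' q', where p' and q'
   are the derivatives of p and q, as the second derivatives of p and q vanish. *)
Lemma disjoint_pvars p q : multilinear p -> multilinear q -> multilinear (p * q) ->
  [disjoint pvars p & pvars q].
Proof.
move=> lp lq lpq; rewrite -setI_eq0; apply/eqP/setP => i.
have := multilinear_mderiv2 i lpq.
rewrite mderivM mderivD !mderivM !multilinear_mderiv2 // mul0r mulr0 add0r addr0.
rewrite -mulr2n -scaler_nat -mul_mpolyC => /eqP.
by rewrite !mulf_eq0 mpolyC_eq0 pnatr_eq0 /= !inE -negb_or => ->.
Qed.

Lemma multilinear_formula_poly (F : formula R n) :
  multilinear_formula F -> multilinear (formula_poly F).
Proof. by case: F => [a|i|F G|F G] []. Qed.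

(* Cancellations in a sum can make the set of variables of the polynomial smaller
   than that of the formula; computes_on then sets the vanished variables to 0. *)
Lemma formula_computes (F : formula R n) : multilinear_formula F ->
  computes (formula_size F) (pvars (formula_poly F))
    (fun x => meval (point x) (formula_poly F)).
Proof.
elim: F => [a _|i _|F1 IH1 F2 IH2 /= [_ [/IH1 c1 /IH2 c2]]|F1 IH1 F2 IH2 /= [lF [l1 l2]]];
  apply: computes_on (@meval_depends _) _.
- apply: (@ComputesLeaf _ _ set0); first by rewrite cards0.
  by move=> x y _; rewrite !mevalC.
- apply: (@ComputesLeaf _ _ [set i]); first by rewrite cards1.
  by move=> x y xy; rewrite !mevalXU /point xy ?inE.
- rewrite (_ : (fun _ => _) = (fun x => meval (point x) (formula_poly F1)) \+
                              (fun x => meval (point x) (formula_poly F2))).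
    apply: ComputesAdd.
      exact: ComputesWiden (leqnn _) (subsetUl _ (pvars (formula_poly F2))) c1.
    exact: ComputesWiden (leqnn _) (subsetUr (pvars (formula_poly F1)) _) c2.
  by apply/funext => x; rewrite mevalD.
- rewrite (_ : (fun _ => _) = (fun x => meval (point x) (formula_poly F1)) \*
                              (fun x => meval (point x) (formula_poly F2))).
    apply: ComputesMul (IH1 l1) (IH2 l2).
    by apply: disjoint_pvars; rewrite //; apply: multilinear_formula_poly.
  by apply/funext => x; rewrite mevalM.
Qed.

(** Existence of formulas keeps the minima in [MFS] off the default value 0. The exponent bound
    encodes multilinearity and support in [S] together. *)
Definition has_formula S p :=
  (forall m, m \in msupp p -> forall i, (m i <= (i \in S))%N) /\
  exists F : formula R n, multilinear_formula F /\ formula_poly F = p.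

Lemma has_formula_multilinear S p : has_formula S p -> multilinear p.
Proof. by move=> [sp _] m mp i; apply: leq_trans (sp m mp i) (leq_b1 _). Qed.

Lemma has_formulaS S T p : S \subset T -> has_formula S p -> has_formula T p.
Proof.
move=> /subsetP sST [sp Fp]; split=> // m mp i; apply: leq_trans (sp m mp i) _.
by case: (boolP (i \in S)) => // /sST ->.
Qed.

Lemma has_formulaC S c : has_formula S (mpolyC n c).
Proof.
have sp m : m \in msupp (mpolyC n c) -> forall i, (m i <= (i \in S))%N.
  by rewrite msuppC; case: eqP => // _; rewrite inE => /eqP-> i; rewrite mnm0E.
split=> //; exists (FConst n c); split=> //; split=> // m mp i.
exact: leq_trans (sp m mp i) (leq_b1 _).
Qed.

Lemma has_formulaX i : has_formula [set i] (X i).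
Proof.
have sp m : m \in msupp (X i) -> forall j, (m j <= (j \in [set i]))%N.
  by rewrite msuppX inE => /eqP-> j; rewrite mnm1E inE eq_sym.
split=> //; exists (FVar R i); split=> //; split=> // m mp j.
exact: leq_trans (sp m mp j) (leq_b1 _).
Qed.

Lemma has_formulaD S p q : has_formula S p -> has_formula S q -> has_formula S (p + q).
Proof.
move=> [sp [F [lF Fp]]] [sq [G [lG Gq]]].
have spq m : m \in msupp (p + q) -> forall i, (m i <= (i \in S))%N.
  by move=> /msuppD_le; rewrite mem_cat => /orP[/sp|/sq].
split=> //; exists (FAdd F G); rewrite /= Fp Gq; split=> //; split=> // m mp i.
exact: leq_trans (spq m mp i) (leq_b1 _).
Qed.

Lemma has_formulaM S T p q : [disjoint S & T] ->
  has_formula S p -> has_formula T q -> has_formula (S :|: T) (p * q).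
Proof.
move=> dST [sp [F [lF Fp]]] [sq [G [lG Gq]]].
have spq m : m \in msupp (p * q) -> forall i, (m i <= (i \in S :|: T))%N.
  move=> /msuppM_le/allpairsP[[m1 m2] /= [/sp m1p /sq m2q ->]] i.
  rewrite mnmDE inE; apply: leq_trans (leq_add (m1p i) (m2q i)) _.
  by case: (boolP (i \in S)) => // /(disjointFr dST) ->.
split=> //; exists (FMul F G); rewrite /= Fp Gq; split=> //; split=> // m mp i.
exact: leq_trans (spq m mp i) (leq_b1 _).
Qed.

Lemma has_formula_prod (P : 'I_n -> MP) (r : seq 'I_n) : uniq r ->
  (forall i, has_formula [set i] (P i)) -> has_formula [set i in r] (\prod_(i <- r) P i).
Proof.
move=> + hP; elim: r => [_|i r IH /= /andP[ir ur]].
  by rewrite big_nil -mpolyC1; apply: has_formulaC.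
rewrite big_cons set_cons; apply: has_formulaM (IH ur) => //.
by rewrite disjoints1 inE.
Qed.

Lemma has_formula_prodT (P : 'I_n -> MP) :
  (forall i, has_formula [set i] (P i)) -> has_formula [set: 'I_n] (\prod_i P i).
Proof.
move=> /(has_formula_prod (index_enum_uniq _)); apply: has_formulaS.
exact: subsetT.
Qed.

Lemma has_formula_sum S (I : eqType) (r : seq I) (P : I -> MP) :
  (forall i, i \in r -> has_formula S (P i)) -> has_formula S (\sum_(i <- r) P i).
Proof.
elim: r => [_|i r IH hP]; first by rewrite big_nil -mpolyC0; apply: has_formulaC.
rewrite big_cons; apply: has_formulaD; first exact/hP/mem_head.
by apply: IH => j jr; apply: hP; rewrite inE jr orbT.
Qed.

Lemma has_formulaZ c p :
  has_formula [set: 'I_n] p -> has_formula [set: 'I_n] (mpolyC n c * p).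
Proof.
rewrite -{2}(set0U setT); apply: has_formulaM (has_formulaC _ _).
by rewrite -setI_eq0 set0I.
Qed.

Lemma multilinear_has_formula p : multilinear p -> has_formula [set: 'I_n] p.
Proof.
move=> lp; rewrite [p]mpolyE; apply: has_formula_sum => m mp.
rewrite -mul_mpolyC; apply: has_formulaZ; rewrite mpolyXE_id.
apply: has_formula_prodT => i; have := lp m mp i; case: (m i) => [_|[_|//]].
  by rewrite expr0 -mpolyC1; apply: has_formulaC.
by rewrite expr1; apply: has_formulaX.
Qed.

Lemma interpolation (f : bits n -> C) : exists p,
  multilinear p /\ forall x, meval (point x) p = f x.
Proof.
pose L (x : bits n) i : MP := if x i then X i else mpolyC n 1 + mpolyC n (-1) * X i.
have hL x i : has_formula [set i] (L x i).
  rewrite /L; case: ifP => _; first exact: has_formulaX.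
  apply: has_formulaD (has_formulaC _ _) _; rewrite -(set0U [set i]).
  apply: has_formulaM (has_formulaC _ _) (has_formulaX _).
  by rewrite -setI_eq0 set0I.
exists (\sum_x mpolyC n (f x) * \prod_i L x i); split.
  apply: (@has_formula_multilinear setT); apply: has_formula_sum => x _.
  by apply/has_formulaZ/has_formula_prodT.
have LE x y : meval (point y) (\prod_i L x i) = (x == y)%:R.
  rewrite (big_morph _ (mevalM _) (meval1 _)).
  have Li i : meval (point y) (L x i) = (x i == y i)%:R.
    rewrite /L; case: (x i); first by rewrite mevalXU /point; case: (y i).
    rewrite mevalD mevalM !mevalC mevalXU /point mulN1r.
    by case: (y i); rewrite ?subrr ?subr0.
  case: (eqVneq x y) Li => [->|xy] Li; first by rewrite big1 // => i _; rewrite Li ?eqxx.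
  have /existsP[i xyi] : [exists i, x i != y i].
    rewrite -negb_forall; apply: contraNN xy => /forallP xy.
    by apply/eqP/ffunP => i; apply/eqP.
  by rewrite (bigD1 i) //= Li (negPf xyi) mul0r.
move=> y; rewrite (big_morph _ (mevalD _) (meval0 _)).
under eq_bigr do rewrite mevalM mevalC LE.
rewrite (bigD1 y) //= eqxx mulr1 big1 ?addr0 // => x /negPf ->.
by rewrite mulr0.
Qed.

(** Interpolation and monomial expansion show that both minima are attained, so [MFS f] is the size
    of an actual formula. *)
Lemma leq_MFS (f : bits n -> C) k :
  (forall s, computes s [set: 'I_n] f -> (k <= s)%N) -> (k <= MFS f)%N.
Proof.
move=> fk.
have [p0 [lp0 p0f]] := interpolation f.
have [] := @nat_minP (fun k => exists p : MP, [/\ multilinear p,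
  forall x : bits n, meval (fun i => (x i)%:R) p = f x & MFS_poly p = k]).
  by exists (MFS_poly p0), p0.
move=> [p [lp pf pk]] _.
have [_ [F [lF Fp]]] := multilinear_has_formula lp.
have [] := @nat_minP (fun k => exists F : formula R n,
  [/\ multilinear_formula F, formula_poly F = p & formula_size F = k]).
  by exists (formula_size F), F.
move=> [G [lG Gp Gk]] _; have -> : MFS f = formula_size G := etrans (esym pk) (esym Gk).
apply: fk.
apply: ComputesWiden (leqnn _) (subsetT _) _.
  rewrite (_ : f = fun x => meval (point x) (formula_poly G)).
    exact: formula_computes lG.
  by apply/funext => x; rewrite Gp -pf.
Qed.

End Formulas.

(** * Quantum state trees *)

Section ComputesBig.
Variables (n : nat) (K : fieldType).

Lemma computes_sum k (s : 'I_k.+1 -> nat) S (f : 'I_k.+1 -> bits n -> K) :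
  (forall j, computes (s j) S (f j)) ->
  computes (\sum_j s j)%N S (fun x => \sum_j f j x).
Proof.
elim: k s f => [|k IH] s f cf.
  rewrite big_ord1 (_ : (fun _ => _) = f ord0) //.
  by apply/funext => x; rewrite big_ord1.
rewrite big_ord_recl.
rewrite (_ : (fun _ => _) = f ord0 \+ (fun x => \sum_j f (lift ord0 j) x)).
  exact: ComputesAdd (cf _) (IH _ _ (fun j => cf (lift ord0 j))).
by apply/funext => x; rewrite big_ord_recl.
Qed.

Lemma computes_prod k (s : 'I_k.+1 -> nat) (S : 'I_k.+1 -> {set 'I_n})
    (f : 'I_k.+1 -> bits n -> K) :
  (forall j, computes (s j) (S j) (f j)) ->
  (forall i j, i != j -> [disjoint S i & S j]) ->
  computes (\sum_j s j)%N (\bigcup_j S j) (fun x => \prod_j f j x).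
Proof.
elim: k s S f => [|k IH] s S f cf dS.
  rewrite !big_ord1 (_ : (fun _ => _) = f ord0) //.
  by apply/funext => x; rewrite big_ord1.
rewrite !(big_ord_recl k.+1).
rewrite (_ : (fun _ => _) = f ord0 \* (fun x => \prod_j f (lift ord0 j) x)).
  have d : [disjoint S ord0 & \bigcup_(j < k.+1) S (lift ord0 j)].
    by apply: bigcup_disjoint => j _; rewrite dS.
  apply: ComputesMul d (cf _)
    (IH _ (fun j => S (lift ord0 j)) (fun j => f (lift ord0 j)) _ _).
    by move=> j; apply: cf.
  by move=> i j ij; apply: dS; rewrite (inj_eq lift_inj).
by apply/funext => x; rewrite big_ord_recl.
Qed.

End ComputesBig.

Section Trees.
Variables (R : realType) (n : nat).
Local Notation C := (R[i]).
Implicit Types (t : qtree R n) (x y : bits n) (S : {set bits n}).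

(** Gates unfold into binary ones without extra leaves, [computes_scale] absorbs edge labels, and
    the partition makes tensor factors disjoint. *)
Lemma qtree_computes t : well_formed t -> computes (leaves t) (qubits t) (amplitude t).
Proof.
elim: t => [i a b _|Q k a w IH [_ wP]|Q k w IH [_ [pQ iQ wP]]] /=.
- apply: ComputesLeaf; first by rewrite cards1.
  by move=> x y xy; rewrite xy ?inE.
- apply: computes_sum => j; apply: computes_scale.
  by have [<- wj] := wP j; apply: IH.
- have -> : Q = \bigcup_j qubits (w j).
    by rewrite -(cover_partition pQ) cover_imset; apply: eq_bigl.
  apply: computes_prod => [j|i j ij]; first exact: IH (wP j).
  apply: (trivIsetP (partition_trivIset pQ)); rewrite ?imset_f //.
  by rewrite (inj_eq iQ).
Qed.

Lemma normalized_delta (Q : {set 'I_n}) (psi : state R n) x :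
  [forall i, x i ==> (i \in Q)] ->
  (forall y, [forall i, y i ==> (i \in Q)] -> psi y = (y == x)%:R) ->
  normalized Q psi.
Proof.
move=> xQ psiE; rewrite /normalized (bigD1 x) //= psiE // eqxx normr1 expr1n.
rewrite big1 ?addr0 // => y /andP[yQ /negPf yx].
by rewrite psiE // yx normr0 expr0n.
Qed.

Definition basis_leaf x i : qtree R n := QLeaf i (~~ x i)%:R (x i)%:R.

Lemma basis_leaf_well_formed x i : well_formed (basis_leaf x i).
Proof.
split=> //=; apply: (@normalized_delta _ _ [ffun j => x i && (j == i)]).
  by apply/forallP => j; rewrite ffunE inE; apply/implyP => /andP[].
move=> y /forallP yi; have -> : (y == [ffun j => x i && (j == i)]) = (y i == x i).
  apply/eqP/eqP => [->|e]; first by rewrite ffunE eqxx andbT.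
  apply/ffunP => j; rewrite ffunE; have [->|ji] := eqVneq j i; first by rewrite e andbT.
  by rewrite andbF; have := yi j; rewrite inE (negPf ji) implybF => /negPf.
by case: (y i); case: (x i).
Qed.

End Trees.

Section UniformState.
Local Open Scope complex_scope.
Variables (R : realType) (n : nat).
Local Notation C := (R[i]).
Implicit Types (x y : bits n.+1) (S : {set bits n.+1}).

Definition basis_tree x : qtree R n.+1 :=
  QTensor [set: 'I_n.+1] (fun i : 'I_n.+1 => basis_leaf R x i).

Lemma basis_tree_amplitude x y : amplitude (basis_tree x) y = (y == x)%:R.
Proof.
rewrite /=; have Li i : (if y i then (x i)%:R else (~~ x i)%:R) = (y i == x i)%:R :> C.
  by case: (y i); case: (x i).
under eq_bigr do rewrite Li.
case: (eqVneq y x) {Li} => [->|yx]; first by rewrite big1 // => i _; rewrite eqxx.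
have /existsP[i xyi] : [exists i, y i != x i].
  rewrite -negb_forall; apply: contraNN yx => /forallP xy.
  by apply/eqP/ffunP => i; apply/eqP.
by rewrite (bigD1 i) //= (negPf xyi) mul0r.
Qed.

Lemma basis_tree_well_formed x : well_formed (basis_tree x).
Proof.
split.
  apply: (@normalized_delta _ _ _ _ x); last by move=> y _; apply: basis_tree_amplitude.
  by apply/forallP => i; rewrite inE implybT.
split=> [|i j /set1_inj|j] //; last exact: basis_leaf_well_formed.
apply/and3P; split.
- rewrite eqEsubset subsetT; apply/subsetP => i _; apply/bigcupP.
  by exists [set i]; [apply: imset_f | rewrite inE].
- apply/trivIsetP => _ _ /imsetP[i _ ->] /imsetP[j _ ->] /= ij.
  by rewrite disjoints1 inE; apply: contraNneq ij => ->.
- by apply/negP => /imsetP[i _ /setP/(_ i)]; rewrite !inE eqxx.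
Qed.

Lemma uniform_state_represented S : (0 < #|S|)%N ->
  exists t, represents t (uniform_state R S).
Proof.
move=> S0; set c := ((Num.sqrt (#|S|%:R : R))^-1)%:C.
pose x0 : bits n.+1 := [ffun=> false].
(* One child per element of [S]; gates have fan-in at least 1, hence the index type and the use of 0
   < [#|S|]. *)
pose w (j : 'I_#|S|.-1.+1) := basis_tree (nth x0 (enum S) j).
pose t := QPlus [set: 'I_n.+1] (fun=> c) w.
have tE : amplitude t =1 uniform_state R S.
  move=> x; rewrite /= -big_distrr /= /uniform_state -/c; congr (_ * _).
  rewrite (eq_bigr (fun j : 'I_#|S|.-1.+1 => (x == nth x0 (enum S) j)%:R)); last first.
    by move=> j _; apply: basis_tree_amplitude.
  rewrite -(big_mkord xpredT (fun j => (x == nth x0 (enum S) j)%:R)) prednK //.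
  rewrite cardE -(big_nth x0 xpredT (fun y => (x == y)%:R)) big_enum /=.
  case: (boolP (x \in S)) => xS.
    rewrite (bigD1 x) //= eqxx big1 ?addr0 // => y /andP[_].
    by rewrite eq_sym => /negPf ->.
  by rewrite big1 // => y yS; case: eqP => // xy; rewrite xy yS in xS.
exists t; split=> //; split; last by move=> j; split=> //; apply: basis_tree_well_formed.
rewrite /normalized (eq_bigr (fun x => if x \in S then `|c| ^+ 2 else 0)); last first.
  move=> x _; rewrite tE /uniform_state -/c.
  by case: (x \in S); rewrite ?mulr1 ?mulr0 ?normr0 ?expr0n.
rewrite -big_mkcondr /= (eq_bigl (mem S)); last first.
  move=> x; rewrite (_ : [forall i, _] = true) //.
  by apply/forallP => i; rewrite inE implybT.
rewrite sumr_const /c ger0_norm; last by rewrite (lecR 0) invr_ge0 sqrtr_ge0.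
rewrite -rmorphXn /= exprVn sqr_sqrtr ?ler0n // -rmorphMn /= -mulr_natr mulVf //.
by rewrite pnatr_eq0 -lt0n.
Qed.

End UniformState.

Section TreeSize.
Local Open Scope complex_scope.
Variables (R : realType) (n : nat).
Implicit Types S : {set bits n}.

Lemma computes_uniform_state s (Q : {set 'I_n}) S : (0 < #|S|)%N ->
  computes s Q (uniform_state R S) -> computes s Q (indicator R S).
Proof.
move=> S0; set c := ((Num.sqrt (#|S|%:R : R))^-1)%:C.
move=> /(computes_scale c^-1); congr computes; apply/funext => x.
rewrite /uniform_state -/c mulKf // /c fmorph_eq0 invr_eq0 sqrtr_eq0 -ltNge.
by rewrite ltr0n.
Qed.

Lemma leq_TS S k : (0 < n)%N -> (0 < #|S|)%N ->
  (forall s, computes s [set: 'I_n] (indicator R S) -> (k <= s)%N) ->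
  (k <= TS (uniform_state R S))%N.
Proof.
move=> n0 S0 Sk.
have [t tS] : exists t, represents t (uniform_state R S).
  by case: (n) S n0 S0 {Sk} => // n' S _; apply: uniform_state_represented.
have [] := @nat_minP (fun k => exists t : qtree R n,
  represents t (uniform_state R S) /\ leaves t = k).
  by exists (leaves t), t.
move=> [u [[wu uT uS] uk]] _.
have -> : TS (uniform_state R S) = leaves u := esym uk.
apply: Sk; apply: computes_uniform_state => //.
by rewrite -uT -(funext uS); apply: qtree_computes.
Qed.

End TreeSize.

(** * The lower bound *)

(** Every matrix has the same weight 2^(-mn), so counting suffices. *)
Lemma Pr_ge_half (R : realType) m n (G : {set 'M['F_2]_(m, n)})
    (E : 'M['F_2]_(m, n) -> Prop) :
  (#|{: 'M['F_2]_(m, n)}| <= 2 * #|G|)%N -> (forall A, A \in G -> E A) ->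
  2^-1 <= Pr R E.
Proof.
move=> hG GE; rewrite /Pr.
have coinE (A : 'M['F_2]_(m, n)) :
    \prod_(i < m) \prod_(j < n) coin R (A i j) = (2 ^+ (m * n))^-1.
  rewrite /coin; under eq_bigr do rewrite prodr_const card_ord.
  by rewrite prodr_const card_ord -exprM mulnC exprVn.
rewrite (eq_bigr _ (fun A _ => coinE A)) sumr_const.
have cM : #|{: 'M['F_2]_(m, n)}| = (2 ^ (m * n))%N by rewrite card_mx card_Fp.
have GE' : (#|G| <= #|[pred A | `[< E A >]]|)%N.
  by apply/subset_leq_card/subsetP => A AG; rewrite inE; apply/asboolP/GE.
rewrite -[leRHS]mulr_natr ler_pdivlMl ?exprn_gt0 // ler_pdivrMr //.
rewrite -natrX -natrM ler_nat -cM mulnC; apply: leq_trans hG _.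
by rewrite leq_mul2l.
Qed.

(** The left side is exp(c (ln n)^2), and ln n <= 16(a+1) ln 2 <= 32 a ln 2; c = 1/32^2 cancels the
    constant, and (ln 2)^2 <= ln 2. *)
Lemma quasipoly_le (R : realType) n a : (1 <= a)%N -> (1 <= n)%N ->
  (n < 2 ^ (16 * a.+1))%N ->
  n%:R `^ (1024^-1 * ln n%:R) <= (2 ^ a ^ 2)%:R :> R.
Proof.
move=> a1 n1 na.
have n0 : 0 < n%:R :> R by rewrite ltr0n.
have l2 : 0 < ln 2 :> R by rewrite ln_gt0 // ltr1n.
have l2' : ln 2 <= 1 :> R by have := @le_ln1Dx R 1; rewrite -natr1 /=; apply; lra.
have ln0 : 0 <= ln n%:R :> R by rewrite ln_ge0 // ler1n.
have lnn : ln n%:R <= (16 * a.+1)%:R * ln 2 :> R.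
  rewrite mulr_natl -lnXn // ler_ln ?posrE ?exprn_gt0 // -natrX ler_nat.
  exact: ltnW.
rewrite /powR gt_eqF // natrX -[X in _ <= X ^+ _]lnK ?posrE // -expRM_natl.
rewrite ler_expR.
have ha : (16 * a.+1)%:R <= 32 * a%:R :> R by rewrite -natrM ler_nat; lia.
have {}lnn : ln n%:R <= 32 * a%:R * ln 2 :> R.
  by apply: le_trans lnn _; rewrite ler_wpM2r // ltW.
rewrite natrX -mulrA ler_pdivrMl //.
apply: le_trans (ler_pM ln0 ln0 lnn lnn) _.
rewrite -!expr2 !exprMn.
have : ln 2 ^+ 2 <= ln 2 :> R by rewrite expr2 ger_pMr.
have : 0 <= (a%:R : R) ^+ 2 by rewrite sqr_ge0.
nra.
Qed.

Theorem theorem12 (R : realType) :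
  exists c c' : R, [/\ 0 < c, 0 < c' &
    exists N : nat, forall n : nat, (N <= n)%N -> ~~ odd n ->
      c' <= Pr R (fun A : 'M['F_2]_(n./2, n) =>
        n%:R `^ (c * ln n%:R) <= (MFS (indicator R (kernel_set A)))%:R :> R /\
        n%:R `^ (c * ln n%:R) <= (TS (uniform_state R (kernel_set A)))%:R :> R)].
Proof.
exists 1024^-1, 2^-1; split; rewrite ?invr_gt0 //.
(* 112 = 16 * 7 ensures 7 <= a. *)
pose N := (fun k => 2 ^ k)%N 112%N; exists N => n Nn evn.
have nm : n = n./2.*2 by rewrite -[LHS]odd_double_half (negPf evn).
have n0 : (0 < n)%N by apply: leq_trans Nn; rewrite expn_gt0.
pose a := (trunc_log 2 n %/ 16)%N.
have a7 : (7 <= a)%N.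
  by rewrite /a leq_divRL // trunc_log_max.
have an : (2 ^ (16 * a) <= n < 2 ^ (16 * a.+1))%N.
  have /andP[l1 l2] := trunc_log_bounds (isT : 1 < 2)%N n0.
  apply/andP; split.
    by apply: leq_trans l1; rewrite leq_exp2l // mulnC leq_divM.
  by apply: leq_trans l2 _; rewrite leq_exp2l // mulnC ltn_ceil.
apply: (Pr_ge_half R (card_typical nm)) => A tA.
have lower s : computes s [set: 'I_n] (indicator R (kernel_set A)) -> (2 ^ a ^ 2 <= s)%N.
  exact: computes_typical nm a7 an tA.
have S0 : (0 < #|kernel_set A|)%N.
  apply/card_gt0P; exists [ffun=> false]; rewrite in_kernel.
  rewrite (_ : vec _ = 0) ?mulmx0 //.
  by apply/matrixP => i j; rewrite !mxE ffunE.
have hn : n%:R `^ (1024^-1 * ln n%:R) <= (2 ^ a ^ 2)%:R :> R.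
  by apply: quasipoly_le => //; [lia | case/andP: an].
by split; apply: le_trans hn _; rewrite ler_nat; [apply: leq_MFS | apply: leq_TS].
Qed.
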